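(* Let $I,C\ge 1$ be integers, let $e_{ijc}\in[0,1]$ and $\alpha_{ic}\ge 0$ for $i,j\in\{1,\dots,I\}$, $c\in\{1,\dots,C\}$, and let $R>0$. Put $\Lambda=R+\sum_{i=1}^I\sum_{c=1}^C\alpha_{ic}$, let $\overline{E}=(\overline{e}_{ij})$ be the $I\times I$ matrix with $\overline{e}_{ij}=\Lambda^{-1}\sum_{c=1}^C\alpha_{ic}e_{jic}$, and let $A=(a_{ij})=(\overline{E}-Id_I)^{-1}$. Suppose that $\sum_{j=1}^I\overline{e}_{ij}<1$ for all $i$ (so that $A$ is well defined), and that $\gamma\in\mathbb{R}_+$ satisfies $$\gamma>(\Lambda R)^{-1}I^2\Big(\max_{i,j}a_{ij}-\min_{i,j}a_{ij}\Big).$$ Then the opinion centrality vector $\lambda^{O}=(\lambda_1^O,\dots,\lambda_I^O)$, i.e. the optimum of the Regularized Opinion Maximization Problem, is given, for all $j\in\{1,\dots,I\}$, by $$\lambda_j^{O}=\frac{R}{I}+\frac{1}{\gamma I\Lambda}\sum_{i=1}^I\sum_{l=1}^I a_{il}-\frac{1}{\gamma\Lambda}\sum_{i=1}^I a_{ij}.$$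
   Context: $Id_I$ is the $I\times I$ identity matrix. For $\lambda=(\lambda_1,\dots,\lambda_I)$ with $\lambda_i\ge 0$ for all $i$ and $\sum_{i=1}^I\lambda_i=R$, the vector $\mathbf{x}^*(\lambda)=(x_1^*(\lambda),\dots,x_I^*(\lambda))$ is the solution of the linear system $$\lambda_i\Lambda^{-1}+\Lambda^{-1}\sum_{c=1}^C\alpha_{ic}\sum_{j=1}^I e_{jic}\,x_j^*(\lambda)-x_i^*(\lambda)=0,\qquad i=1,\dots,I.$$ (Under the hypothesis $\sum_{j}\overline{e}_{ij}<1$ for all $i$, this solution exists and is unique.) The Regularized Opinion Maximization Problem with budget $R$ and regularization coefficient $\gamma$ is $$\max_{\lambda}\ \sum_{i=1}^I x_i^*(\lambda)-\frac{\gamma}{2}\sum_{i=1}^I\lambda_i^2\qquad\text{subject to } \lambda_i\ge 0 \text{ for all } i,\quad \sum_{i=1}^I\lambda_i=R.$$ The opinion centrality $\lambda^O$ is the (unique) optimum of this problem. *)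

(* Defs.v *)
From HB Require Import structures.
From mathcomp Require Import all_boot all_order all_algebra.
From mathcomp Require Import boolp classical_sets reals.
Set Implicit Arguments.
Unset Strict Implicit.
Unset Printing Implicit Defensive.
Import Order.TTheory GRing.Theory Num.Theory.
Local Open Scope ring_scope.

(* There are n.+1 individuals and m.+1 channels; [e i j c] is e_{ijc},
   [alpha i c] is alpha_{ic}, and B is the budget. *)

Definition Lam (R : realType) (n m : nat) (alpha : 'I_n.+1 -> 'I_m.+1 -> R)
    (B : R) : R :=
  B + \sum_(i < n.+1) \sum_(c < m.+1) alpha i c.

(* The first two indices of e are swapped with respect to those of the
   matrix: entry (i, j) involves e_{jic}. *)
Definition Ebar (R : realType) (n m : nat)
    (e : 'I_n.+1 -> 'I_n.+1 -> 'I_m.+1 -> R)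
    (alpha : 'I_n.+1 -> 'I_m.+1 -> R) (B : R) : 'M[R]_n.+1 :=
  \matrix_(i, j) ((Lam alpha B)^-1 * \sum_(c < m.+1) alpha i c * e j i c).

(* [invmx] is the inverse only when its argument is in [unitmx]. *)
Definition Amx (R : realType) (n m : nat)
    (e : 'I_n.+1 -> 'I_n.+1 -> 'I_m.+1 -> R)
    (alpha : 'I_n.+1 -> 'I_m.+1 -> R) (B : R) : 'M[R]_n.+1 :=
  invmx (Ebar e alpha B - 1%:M).

(* The seed of the iterated max (min) is itself an entry, so that these are
   the true extrema over all entries. *)
Definition mxmax (R : realType) (n : nat) (A : 'M[R]_n.+1) : R :=
  \big[Num.max/A ord0 ord0]_(i < n.+1) \big[Num.max/A ord0 ord0]_(j < n.+1) A i j.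

Definition mxmin (R : realType) (n : nat) (A : 'M[R]_n.+1) : R :=
  \big[Num.min/A ord0 ord0]_(i < n.+1) \big[Num.min/A ord0 ord0]_(j < n.+1) A i j.

Definition opinion_system (R : realType) (n m : nat)
    (e : 'I_n.+1 -> 'I_n.+1 -> 'I_m.+1 -> R)
    (alpha : 'I_n.+1 -> 'I_m.+1 -> R) (B : R) (lam x : 'cV[R]_n.+1) : Prop :=
  forall i : 'I_n.+1,
    lam i 0 * (Lam alpha B)^-1
    + (Lam alpha B)^-1
      * (\sum_(c < m.+1) alpha i c * \sum_(j < n.+1) e j i c * x j 0)
    - x i 0 = 0.

(* The solution of the system; the value is 0 if there is none. *)
Definition xstar (R : realType) (n m : nat)
    (e : 'I_n.+1 -> 'I_n.+1 -> 'I_m.+1 -> R)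
    (alpha : 'I_n.+1 -> 'I_m.+1 -> R) (B : R) (lam : 'cV[R]_n.+1) :
    'cV[R]_n.+1 :=
  xget 0 [set x | opinion_system e alpha B lam x]%classic.

Definition feasible (R : realType) (n : nat) (B : R) (lam : 'cV[R]_n.+1) :
    Prop :=
  (forall i, 0 <= lam i 0) /\ \sum_(i < n.+1) lam i 0 = B.

Definition objective (R : realType) (n m : nat)
    (e : 'I_n.+1 -> 'I_n.+1 -> 'I_m.+1 -> R)
    (alpha : 'I_n.+1 -> 'I_m.+1 -> R) (B gamma : R) (lam : 'cV[R]_n.+1) : R :=
  \sum_(i < n.+1) xstar e alpha B lam i 0
  - gamma / 2 * \sum_(i < n.+1) lam i 0 ^+ 2.

Definition is_opinion_centrality (R : realType) (n m : nat)
    (e : 'I_n.+1 -> 'I_n.+1 -> 'I_m.+1 -> R)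
    (alpha : 'I_n.+1 -> 'I_m.+1 -> R) (B gamma : R) (lam : 'cV[R]_n.+1) :
    Prop :=
  feasible B lam /\
  forall mu : 'cV[R]_n.+1, feasible B mu ->
    objective e alpha B gamma mu <= objective e alpha B gamma lam.

(* Main.v *)
(* Strict row dominance makes Ebar - Id invertible, so x* = - Lam^-1 A lam and
   the objective is a concave quadratic in lam, with linear coefficients given by
   the column sums of A.  The claimed vector is the stationary point on the
   hyperplane \sum_i lam_i = B; the bound on gamma keeps its
   entries nonnegative, and completing the square shows that any other feasible
   vector loses gamma / 2 times its squared distance to it. *)
Require Import Defs.
From HB Require Import structures.
From mathcomp Require Import all_boot all_order all_algebra.
From mathcomp Require Import boolp classical_sets reals.
From mathcomp Require Import ring lra.
Set Implicit Arguments.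
Unset Strict Implicit.
Unset Printing Implicit Defensive.
Import Order.TTheory GRing.Theory Num.Theory.
Local Open Scope ring_scope.

(** Maximum-modulus argument: a nonzero [v] with [E v = v] would satisfy
    [|v i| <= (\sum_j E i j) * |v i| < |v i|] at an index [i] where [|v i|] is largest. Since
    [det0P] yields row vectors, it is applied to the transpose, so that the row sums of [E] are the
    ones that enter. *)
Lemma unitmx_sub1 (F : realFieldType) (n : nat) (E : 'M[F]_n) :
  (forall i j, 0 <= E i j) -> (forall i, \sum_j E i j < 1) ->
  E - 1%:M \in unitmx.
Proof.
move=> E0 E1; rewrite -unitmx_tr unitmxE unitfE; apply/det0P => -[v v0 vE].
have {}vE i : v 0 i = \sum_j E i j * v 0 j.
  have /rowP/(_ i) := vE.
  rewrite linearB /= trmx1 mulmxBr mulmx1 !mxE => /subr0_eq <-.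
  by apply: eq_bigr => j _; rewrite !mxE mulrC.
have /rV0Pn[i0 vi0] := v0.
have [i _ imax] := Order.TotalTheory.arg_maxP (fun j => `|v 0 j|) (erefl (xpredT i0)).
have vi : 0 < `|v 0 i| by rewrite (lt_le_trans _ (imax i0 _))// normr_gt0.
suff : `|v 0 i| < `|v 0 i| by rewrite ltxx.
rewrite {1}vE (le_lt_trans (ler_norm_sum _ _ _))//.
rewrite (@le_lt_trans _ _ ((\sum_j E i j) * `|v 0 i|))//; last first.
  by rewrite -[ltRHS]mul1r ltr_pM2r.
rewrite mulr_suml; apply: ler_sum => j _.
by rewrite normrM ger0_norm// ler_wpM2l//; apply: imax.
Qed.

Lemma mxmax_ge (R : realType) (n : nat) (A : 'M[R]_n.+1) i j : A i j <= mxmax A.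
Proof. exact: le_trans (le_bigmax _ _ j) (le_bigmax _ _ i). Qed.

Lemma mxmin_le (R : realType) (n : nat) (A : 'M[R]_n.+1) i j : mxmin A <= A i j.
Proof. exact: le_trans (bigmin_le _ i _) (bigmin_le _ j _). Qed.

(** The left side is the sum over all pairs [(i, l)] of [A i j - A i l], and each of these
    differences is at most the spread of the entries. *)
Lemma col_sum_dist (R : realType) (n : nat) (A : 'M[R]_n.+1) j :
  n.+1%:R * (\sum_i A i j) - \sum_i \sum_l A i l
    <= n.+1%:R ^+ 2 * (mxmax A - mxmin A).
Proof.
rewrite mulr_sumr -sumrB.
have -> : n.+1%:R ^+ 2 * (mxmax A - mxmin A)
    = \sum_(i < n.+1) \sum_(l < n.+1) (mxmax A - mxmin A).
  by rewrite !sumr_const !card_ord -mulrnA -natrX mulr_natl expnS expn1.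
apply: ler_sum => i _.
have -> : n.+1%:R * A i j = \sum_(l < n.+1) A i j.
  by rewrite sumr_const card_ord mulr_natl.
rewrite -sumrB; apply: ler_sum => l _.
by rewrite lerB ?mxmax_ge ?mxmin_le.
Qed.

(* The stationarity condition [w j = g * o j + k], with multiplier [k] for the
   constraint [\sum_i mu i = \sum_i o i], completes the square. *)
Lemma quadratic_gap (F : realFieldType) (I : finType) (w o mu : I -> F) (g k : F) :
  (forall i, w i = g * o i + k) -> \sum_i mu i = \sum_i o i ->
  (\sum_i w i * o i - g / 2 * \sum_i o i ^+ 2)
    - (\sum_i w i * mu i - g / 2 * \sum_i mu i ^+ 2)
  = g / 2 * \sum_i (mu i - o i) ^+ 2.
Proof.
move=> wE S; apply: subr0_eq.
(* Once [w i] is replaced by [g * o i + k], the quadratic terms cancel and only the multiplier term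
   is left. *)
apply: (etrans (y := k * (\sum_i o i - \sum_i mu i)));
  last by rewrite S subrr mulr0.
rewrite -sumrB !mulr_sumr -!sumrB; apply: eq_bigr => i _.
by rewrite wE; field.
Qed.

Section Opinion.
Context (R : realType) (n m : nat).
Context (e : 'I_n.+1 -> 'I_n.+1 -> 'I_m.+1 -> R).
Context (alpha : 'I_n.+1 -> 'I_m.+1 -> R) (B : R).
Local Notation L := (Lam alpha B).
Local Notation E := (Ebar e alpha B).
Local Notation A := (Amx e alpha B).

Lemma opinion_systemE lam x :
  opinion_system e alpha B lam x <-> (E - 1%:M) *m x = - L^-1 *: lam.
Proof.
have EE i : (lam i 0 * L^-1
    + L^-1 * (\sum_(c < m.+1) alpha i c * \sum_(j < n.+1) e j i c * x j 0)
    - x i 0 = 0) <-> ((E - 1%:M) *m x) i 0 = (- L^-1 *: lam) i 0.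
  rewrite mulmxBl mul1mx !mxE.
  have -> : \sum_j E i j * x j 0 = L^-1 *
      (\sum_(c < m.+1) alpha i c * \sum_(j < n.+1) e j i c * x j 0).
    rewrite mulr_sumr; under [RHS]eq_bigr do rewrite !mulr_sumr.
    rewrite exchange_big; apply: eq_bigr => j _ /=.
    rewrite mxE mulr_sumr mulr_suml; apply: eq_bigr => c _.
    by rewrite !mulrA.
  by split=> h; lra.
split=> [h|h i]; last by apply/EE; rewrite h.
by apply/colP => i; apply/EE/h.
Qed.

Hypothesis uE : E - 1%:M \in unitmx.

Lemma opinion_system_solution lam x :
  opinion_system e alpha B lam x <-> x = - L^-1 *: (A *m lam).
Proof.
rewrite opinion_systemE; split=> [h|->].
  by rewrite -[x](mulKmx uE) h -scalemxAr.
by rewrite -scalemxAr mulKVmx.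
Qed.

Lemma xstarE lam : xstar e alpha B lam = - L^-1 *: (A *m lam).
Proof.
(* The default value of [xget] never arises: the explicit solution shows that the set is
   nonempty. *)
rewrite /xstar; case: xgetP => [x _ /opinion_system_solution //|/(_ _)].
by move=> /(_ (- L^-1 *: (A *m lam)))[]; apply/opinion_system_solution.
Qed.

Lemma objectiveE gamma lam :
  objective e alpha B gamma lam =
  \sum_j (- L^-1 * \sum_i A i j) * lam j 0 - gamma / 2 * \sum_i lam i 0 ^+ 2.
Proof.
rewrite /objective xstarE; congr (_ - _).
under eq_bigr do rewrite !mxE mulr_sumr.
rewrite exchange_big; apply: eq_bigr => j _ /=.
by rewrite mulr_sumr mulr_suml; apply: eq_bigr => i _; rewrite mulrA.
Qed.

End Opinion.

Theorem proposition5 (R : realType) (n m : nat)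
    (e : 'I_n.+1 -> 'I_n.+1 -> 'I_m.+1 -> R)
    (alpha : 'I_n.+1 -> 'I_m.+1 -> R) (B gamma : R)
    (he : forall i j c, 0 <= e i j c <= 1)
    (halpha : forall i c, 0 <= alpha i c)
    (hB : 0 < B)
    (hE : forall i, \sum_(j < n.+1) Ebar e alpha B i j < 1)
    (hgamma0 : 0 <= gamma)
    (hgamma : (Lam alpha B * B)^-1 * n.+1%:R ^+ 2
              * (mxmax (Amx e alpha B) - mxmin (Amx e alpha B)) < gamma) :
  [/\ Ebar e alpha B - 1%:M \in unitmx,
      forall lam : 'cV[R]_n.+1, feasible B lam ->
        exists! x : 'cV[R]_n.+1, opinion_system e alpha B lam x
    & forall lam : 'cV[R]_n.+1,
        is_opinion_centrality e alpha B gamma lam <->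
        forall j : 'I_n.+1,
          lam j 0 = B / n.+1%:R
            + (gamma * n.+1%:R * Lam alpha B)^-1
              * (\sum_(i < n.+1) \sum_(l < n.+1) Amx e alpha B i l)
            - (gamma * Lam alpha B)^-1
              * (\sum_(i < n.+1) Amx e alpha B i j)].
Proof.
set L := Lam alpha B; set A := Amx e alpha B.
have L0 : 0 < L by rewrite ltr_wpDr// sumr_ge0// => i _; rewrite sumr_ge0.
have uE : Ebar e alpha B - 1%:M \in unitmx.
  apply: unitmx_sub1 => // i j; rewrite mxE mulr_ge0 ?invr_ge0 ?(ltW L0)//.
  by apply: sumr_ge0 => c _; rewrite mulr_ge0//; have /andP[] := he j i c.
have N0 : 0 < n.+1%:R :> R by rewrite ltr0n.
have g0 : 0 < gamma.
  (* The maximal entry is at least the minimal one, so the strict lower bound on [gamma] is itself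
     nonnegative. *)
  apply: le_lt_trans hgamma; rewrite !mulr_ge0 ?invr_ge0 ?mulr_ge0 ?(ltW L0) ?(ltW hB)//.
  by rewrite subr_ge0 (le_trans (mxmin_le _ 0 0)) ?mxmax_ge.
have [Lne gne Nne] : [/\ L != 0, gamma != 0 & n.+1%:R != 0 :> R].
  by rewrite !gt_eqF.
split=> // [lam _|lam].
  exists (- L^-1 *: (A *m lam)); split=> [|x].
    exact/opinion_system_solution.
  by move=> /(opinion_system_solution uE) ->.
pose s j := \sum_i A i j; pose T := \sum_i \sum_l A i l.
pose o : 'cV[R]_n.+1 := \col_j
  (B / n.+1%:R + (gamma * n.+1%:R * L)^-1 * T - (gamma * L)^-1 * s j).
have sT : \sum_j s j = T by rewrite exchange_big.
have so : \sum_j o j 0 = B.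
  under eq_bigr do rewrite mxE.
  rewrite sumrB -mulr_sumr sT sumr_const card_ord -mulr_natl.
  by field; rewrite Lne gne nat1r Nne.
have fo : feasible B o.
  split=> // j; rewrite mxE.
  (* With the positive factor pulled out, nonnegativity reads
     [n.+1%:R * s j - T <= gamma * (L * B)], which follows from [col_sum_dist] and [hgamma]. *)
  have -> : B / n.+1%:R + (gamma * n.+1%:R * L)^-1 * T - (gamma * L)^-1 * s j
      = (gamma * n.+1%:R * L)^-1 * (gamma * (L * B) - (n.+1%:R * s j - T)).
    by field; rewrite Lne gne nat1r Nne.
  rewrite mulr_ge0 ?invr_ge0 ?mulr_ge0 ?(ltW L0)// subr_ge0.
  apply: le_trans (col_sum_dist A j) _.
  by rewrite -ler_pdivrMr ?mulr_gt0// mulrC mulrA ltW.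
have gap mu : feasible B mu ->
    objective e alpha B gamma o - objective e alpha B gamma mu
    = gamma / 2 * \sum_i (mu i 0 - o i 0) ^+ 2.
  move=> [_ smu]; rewrite !objectiveE//.
  (* The multiplier comes from solving [- L^-1 * s j = gamma * o j 0 + k]; the terms in [s j]
     cancel, so [k] does not depend on [j]. *)
  apply: (quadratic_gap (k := - (gamma * B / n.+1%:R + (n.+1%:R * L)^-1 * T))).
    by move=> j; rewrite mxE -/A -/L -/(s j); field; rewrite Lne gne nat1r Nne.
  by rewrite smu so.
have sq0 mu : 0 <= \sum_i (mu i 0 - o i 0) ^+ 2.
  by rewrite sumr_ge0// => i _; rewrite sqr_ge0.
have opt mu : feasible B mu -> objective e alpha B gamma mu <= objective e alpha B gamma o.
  by move=> /gap h; rewrite -subr_ge0 h mulr_ge0// divr_ge0.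
split=> [[flam /(_ o fo)]|h]; last first.
  suff -> : lam = o by [].
  by apply/colP => j; rewrite h mxE.
(* Uniqueness: if [lam] does at least as well as the feasible [o], the gap is nonpositive, so the
   squared distance from [lam] to [o] vanishes. *)
rewrite -subr_le0 gap// pmulr_rle0 ?divr_gt0// => h j.
have /eqP : \sum_i (lam i 0 - o i 0) ^+ 2 = 0 by apply/eqP; rewrite eq_le h sq0.
rewrite psumr_eq0 => [/allP/(_ j (mem_index_enum j))|i _]; last exact: sqr_ge0.
by rewrite sqrf_eq0 subr_eq0 => /eqP ->; rewrite mxE.
Qed.
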